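(* Let $H$ be a semisimple Hopf algebra over an algebraically closed field $K$ of characteristic zero, and let $V$ be a nonzero finite-dimensional $H$-module. Let $J$ be the intersection of the annihilators in $H$ of all tensor powers $V^{\otimes m}$, $m\ge 0$, which is a Hopf ideal of $H$, and let $A$ be the matrix representing left multiplication by the character of $V$, considered as an $H/J$-module, on the character ring $\operatorname{Ch}(H/J)$ with respect to the basis consisting of the irreducible characters of $H/J$. Then $\operatorname{ind}(A)$ divides $\exp(H)$ and $\operatorname{ord}(V)$.
   Context: A semisimple Hopf algebra is finite-dimensional; let $\varepsilon$ denote the counit. Modules are left modules; tensor powers carry the diagonal action, and $V^{\otimes 0}=K$ is the trivial module. For a semisimple Hopf algebra $L$ over $K$, the character ring $\operatorname{Ch}(L)$ is the subalgebra of the dual algebra $L^*$ (with convolution product) spanned over $K$ by the irreducible characters $\chi_1,\ldots,\chi_k$ of $L$, which form a basis of it; the matrix $A=(a_{ij})$ of left multiplication by a character $\chi$ is determined by $\chi\chi_j=\sum_i a_{ij}\chi_i$ and has nonnegative integer entries. The matrix $A$ in the claim is indecomposable (i.e. there is no partition of the index set into nonempty disjoint sets $M,N$ with $a_{ij}=0$ for all $i\in M,j\in N$); let $\lambda$ be its Perron-Frobenius eigenvalue, i.e. the positive eigenvalue satisfying $|\mu|\le\lambda$ for all complex eigenvalues $\mu$ of $A$. The index of imprimitivity is $\operatorname{ind}(A):=|\{\mu\in\mathbb{C} \mid \mu \text{ is an eigenvalue of } A \text{ with } |\mu|=\lambda\}|$. The exponent $\exp(H)$ is the smallest natural number $m\ge1$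 such that $h_{(1)}h_{(2)}\cdots h_{(m)}=\varepsilon(h)1$ for all $h\in H$ (it is finite under the present assumptions). The order $\operatorname{ord}(V)$ is the smallest natural number $m\ge 1$ such that the space of invariants $(V^{\otimes m})^H=\{w: h.w=\varepsilon(h)w\ \forall h\in H\}$ is nonzero (it is finite for nonzero $V$). *)

(* Defs.v *)
From HB Require Import structures.
From mathcomp Require Import all_boot all_order all_algebra all_field.
From mathcomp Require Import finmap.
From mathcomp Require Import boolp classical_sets cardinality reals complex.

Set Implicit Arguments.
Unset Strict Implicit.
Unset Printing Implicit Defensive.

Import Order.TTheory GRing.Theory Num.Theory.

Local Open Scope ring_scope.

(* The tensor product of finite-dimensional vector spaces is modelled by
   matrices of coordinates: [tens u v] is the matrix of the products of the
   coordinates of u and v in the bases [vbasis {:U}] and [vbasis {:V}], and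
   [tlift f] is the linear map induced by a bilinear map f. The universal
   property is given by [tlift_tens] and [tens_span]. *)
Section Tensor.
Variables (K : fieldType) (U V : vectType K).

Definition tensor := 'M[K]_(\dim {:U}, \dim {:V}).
HB.instance Definition _ := Vector.on tensor.

Definition tens (u : U) (v : V) : tensor :=
  \matrix_(i, j) (coord (vbasis {:U}) i u * coord (vbasis {:V}) j v).

Definition tlift (W : lmodType K) (f : U -> V -> W) (t : tensor) : W :=
  \sum_i \sum_j t i j *: f (vbasis {:U})`_i (vbasis {:V})`_j.

Lemma tlift_is_linear (W : lmodType K) (f : U -> V -> W) : linear (tlift f).
Proof.
move=> a s t; rewrite /tlift scaler_sumr -big_split; apply: eq_bigr => i _ /=.
rewrite scaler_sumr -big_split; apply: eq_bigr => j _ /=.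
by rewrite !mxE scalerDl scalerA.
Qed.
HB.instance Definition _ (W : lmodType K) (f : U -> V -> W) :=
  GRing.isLinear.Build K tensor W _ (tlift f) (tlift_is_linear f).

Definition bilin (W : lmodType K) (f : U -> V -> W) :=
  (forall v, linear (f^~ v)) /\ (forall u, linear (f u)).

End Tensor.

Notation "U ⊗ V" := (tensor U V)
  (at level 40, left associativity) : type_scope.

Section TensorTheory.
Variable K : fieldType.
Implicit Types U V : vectType K.

Lemma linear_sumZ (W1 W2 : lmodType K) (f : W1 -> W2) (I : finType)
    (c : I -> K) (w : I -> W1) :
  linear f -> f (\sum_i c i *: w i) = \sum_i c i *: f (w i).
Proof.
move=> lf; pose F : {linear W1 -> W2} :=
  HB.pack f (GRing.isLinear.Build K W1 W2 _ f lf).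
rewrite -[f]/(F : _ -> _) linear_sum; apply: eq_bigr => i _.
by rewrite linearZ.
Qed.

Lemma tlift_tens U V (W : lmodType K) (f : U -> V -> W) :
  bilin f -> forall u v, tlift f (tens u v) = f u v.
Proof.
move=> [lf1 lf2] u v.
rewrite {2}(coord_vbasis (memvf u)) (linear_sumZ _ _ (lf1 v)).
apply: eq_bigr => i _; rewrite [in RHS](coord_vbasis (memvf v)).
rewrite (linear_sumZ _ _ (lf2 _)) scaler_sumr; apply: eq_bigr => j _.
by rewrite scalerA mxE.
Qed.

Lemma tens_vbasis U V (i : 'I_(\dim {:U})) (j : 'I_(\dim {:V})) :
  tens (vbasis {:U})`_i (vbasis {:V})`_j = delta_mx i j :> U ⊗ V.
Proof.
apply/matrixP=> k l; rewrite !mxE !coord_free ?(basis_free (vbasisP _)) //.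
by rewrite -natrM mulnb (eq_sym i) (eq_sym j).
Qed.

Lemma tens_span U V (t : U ⊗ V) :
  t = \sum_i \sum_j t i j *: tens (vbasis {:U})`_i (vbasis {:V})`_j.
Proof.
rewrite {1}[t]matrix_sum_delta; apply: eq_bigr => i _.
by apply: eq_bigr => j _; rewrite tens_vbasis.
Qed.

Lemma tens_bilin U V : bilin (@tens K U V).
Proof.
split=> [v a u1 u2|u a v1 v2]; apply/matrixP=> i j; rewrite !mxE linearP /=.
  by rewrite mulrDl mulrA.
by rewrite mulrDr mulrCA.
Qed.

Lemma tensor_ind U V (P : U ⊗ V -> Prop) :
  (forall a s t, P s -> P t -> P (a *: s + t)) ->
  (forall u v, P (tens u v)) -> forall t, P t.
Proof.
move=> Plin Ptens t.
have P0 : P 0.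
  suff <- : tens 0 0 = 0 :> U ⊗ V by exact: Ptens.
  by apply/matrixP=> i j; rewrite !mxE !linear0 mul0r.
have PD s1 s2 : P s1 -> P s2 -> P (s1 + s2).
  by move=> Ps1; rewrite -[s1]scale1r; apply: Plin.
rewrite (tens_span t); apply: big_ind => // i _; apply: big_ind => // j _.
by rewrite -[_ *: _]addr0; apply: Plin.
Qed.

Lemma tlift_ext U V (W : lmodType K) (f g : U -> V -> W) :
  f =2 g -> tlift f =1 tlift g.
Proof.
by move=> fg t; apply: eq_bigr => i _; apply: eq_bigr => j _; rewrite fg.
Qed.

Lemma tlift_linear_fun U V (W : lmodType K) (f g : U -> V -> W) a t :
  tlift (fun u v => a *: f u v + g u v) t = a *: tlift f t + tlift g t.
Proof.
rewrite /tlift scaler_sumr -big_split; apply: eq_bigr => i _ /=.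
rewrite scaler_sumr -big_split; apply: eq_bigr => j _ /=.
by rewrite scalerDr !scalerA mulrC.
Qed.

End TensorTheory.

Definition tmap (K : fieldType) (U V U' V' : vectType K)
    (f : U -> U') (g : V -> V') : U ⊗ V -> U' ⊗ V' :=
  tlift (fun u v => tens (f u) (g v)).
HB.instance Definition _ (K : fieldType) (U V U' V' : vectType K)
    (f : U -> U') (g : V -> V') :=
  GRing.Linear.on (tmap f g).

(* (u ⊗ v) ⊗ w |-> u ⊗ (v ⊗ w) *)
Definition tassoc (K : fieldType) (U V W : vectType K) :
    (U ⊗ V) ⊗ W -> U ⊗ (V ⊗ W) :=
  tlift (fun t w => tlift (fun u v => tens u (tens v w)) t).

(* (a ⊗ b)(c ⊗ d) = ac ⊗ bd *)
Definition tmul (K : fieldType) (A B : falgType K) (s t : A ⊗ B) : A ⊗ B :=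
  tlift (fun a b => tlift (fun c d => tens (a * c) (b * d)) t) s.

HB.mixin Record isHopf (K : fieldType) H of Falgebra K H := {
  comul : {linear H -> (H ⊗ H)};
  counit : {linear H -> K^o};
  antipode : {linear H -> H};
  comulA : forall h,
    tassoc (tmap comul idfun (comul h)) = tmap idfun comul (comul h);
  counitl : forall h, tlift (fun a b => counit a *: b) (comul h) = h;
  counitr : forall h, tlift (fun a b => counit b *: a) (comul h) = h;
  comul1 : comul 1 = tens 1 1;
  comulM : forall a b, comul (a * b) = tmul (comul a) (comul b);
  counit1 : counit 1 = 1;
  counitM : forall a b, counit (a * b) = counit a * counit b;
  antipodel : forall h,
    tlift (fun a b => antipode a * b) (comul h) = counit h *: 1;
  antipoder : forall h,
    tlift (fun a b => a * antipode b) (comul h) = counit h *: 1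
}.

#[short(type="hopfAlgType")]
HB.structure Definition HopfAlgebra (K : fieldType) :=
  { H of isHopf K H & Falgebra K H }.

(* Complete reducibility of the left regular module. *)
Definition semisimple (K : fieldType) (A : falgType K) :=
  forall I : {vspace A}, ({:A} * I <= I)%VS ->
  exists I' : {vspace A},
    [/\ ({:A} * I' <= I')%VS, (I + I' = fullv)%VS & (I :&: I' = 0)%VS].

(* A left A-module structure on the vector space V. *)
Record representation (K : fieldType) (A : falgType K) (V : vectType K) :=
  Representation {
    rep_act :> {linear A -> 'End(V)};
    rep1 : rep_act 1 = \1%VF;
    repM : forall a b, rep_act (a * b) = (rep_act a \o rep_act b)%VF
  }.

Definition irreducible (K : fieldType) (A : falgType K) (V : vectType K)
    (rho : representation A V) :=
  {:V}%VS != 0%VS /\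
  forall U : {vspace V}, (forall a, rho a @: U <= U)%VS ->
    U = 0%VS \/ U = fullv.

Section TensorModule.
Variables (K : fieldType) (H : hopfAlgType K).

Definition triv_act (h : H) : 'End(K^o) := (counit h : K) *: \1%VF.

Fact triv_act_is_linear : linear triv_act.
Proof. by move=> a g h; rewrite /triv_act linearP /= scalerDl scalerA. Qed.
HB.instance Definition _ :=
  GRing.isLinear.Build K H 'End(K^o) _ triv_act triv_act_is_linear.

Fact triv_act1 : triv_act 1 = \1%VF.
Proof. by rewrite /triv_act counit1 scale1r. Qed.

Fact triv_actM a b : triv_act (a * b) = (triv_act a \o triv_act b)%VF.
Proof.
by rewrite /triv_act counitM -comp_lfunZl -comp_lfunZr comp_lfun1l scalerA.
Qed.

Definition triv_rep : representation H K^o :=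
  @Representation K H K^o triv_act triv_act1 triv_actM.

Variables (V W : vectType K).
Variables (rho : representation H V) (sigma : representation H W).

Definition pair_act (a b : H) : 'End(V ⊗ W) := linfun (tmap (rho a) (sigma b)).

Lemma tmapE (f : 'End(V)) (g : 'End(W)) v w :
  tmap f g (tens v w) = tens (f v) (g w).
Proof.
have [tl tr] := tens_bilin V W; rewrite /tmap tlift_tens //.
by split=> [w'|v'] a x y; rewrite linearP ?tl ?tr.
Qed.

Lemma pair_actE a b v w :
  pair_act a b (tens v w) = tens (rho a v) (sigma b w).
Proof. by rewrite lfunE /= tmapE. Qed.

Lemma tens_lfunP (f g : 'End(V ⊗ W)) :
  (forall v w, f (tens v w) = g (tens v w)) -> f = g.
Proof.
move=> fg; apply/lfunP; apply: tensor_ind => // a s t fs ft.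
by rewrite !linearP /= fs ft.
Qed.

Lemma pair_act_bilin : bilin pair_act.
Proof.
have [tl tr] := tens_bilin V W.
split=> [b|b] c a1 a2; apply: tens_lfunP => v w;
  by rewrite add_lfunE scale_lfunE !pair_actE linearP add_lfunE scale_lfunE
     ?tl ?tr.
Qed.

(* The diagonal action, h.(v ⊗ w) = h_(1).v ⊗ h_(2).w *)
Definition diag_act : H -> 'End(V ⊗ W) := tlift pair_act \o comul.
HB.instance Definition _ := GRing.Linear.on diag_act.

Fact diag_act1 : diag_act 1 = \1%VF.
Proof.
rewrite /diag_act /= comul1 (tlift_tens pair_act_bilin).
by apply: tens_lfunP => v w; rewrite pair_actE !rep1 !id_lfunE.
Qed.

Lemma tmul_tens (a b c d : H) :
  tmul (tens a b) (tens c d) = tens (a * c) (b * d).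
Proof.
have [tl tr] := tens_bilin H H.
rewrite /tmul tlift_tens; first rewrite tlift_tens //.
  by split=> [x|x] k y z; rewrite mulrDr -scalerAr ?tl ?tr.
by split=> [x|x] k y z; rewrite -tlift_linear_fun; apply: tlift_ext => u v;
  rewrite mulrDl -scalerAl ?tl ?tr.
Qed.

Lemma tmul_linearl t : linear (fun s : H ⊗ H => tmul s t).
Proof. by move=> a s s'; rewrite /tmul linearP. Qed.

Lemma tmul_linearr s : linear (fun t : H ⊗ H => tmul s t).
Proof.
move=> a t t'; rewrite /tmul -tlift_linear_fun; apply: tlift_ext => u v.
by rewrite linearP.
Qed.

Lemma tlift_pair_actM (s t : H ⊗ H) :
  tlift pair_act (tmul s t) = (tlift pair_act s \o tlift pair_act t)%VF.
Proof.
elim/tensor_ind: s => [k s s' IHs IHs'|a b].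
  by rewrite tmul_linearl !linearP /= IHs IHs' comp_lfunDl -comp_lfunZl.
elim/tensor_ind: t => [k t t' IHt IHt'|c d].
  by rewrite tmul_linearr !linearP /= IHt IHt' comp_lfunDr -comp_lfunZr.
rewrite tmul_tens !(tlift_tens pair_act_bilin).
by apply: tens_lfunP => v w; rewrite comp_lfunE !pair_actE !repM !comp_lfunE.
Qed.

Fact diag_actM a b : diag_act (a * b) = (diag_act a \o diag_act b)%VF.
Proof. by rewrite /diag_act /= comulM tlift_pair_actM. Qed.

Definition tens_rep : representation H (V ⊗ W) :=
  @Representation K H (V ⊗ W) diag_act diag_act1 diag_actM.

End TensorModule.

Section TensorPowers.
Variables (K : fieldType) (H : hopfAlgType K).
Variables (V : vectType K) (rho : representation H V).

Fixpoint tpow (m : nat) : vectType K :=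
  if m is m'.+1 then V ⊗ tpow m' else K^o.

Fixpoint tpow_rep (m : nat) : representation H (tpow m) :=
  match m with
  | 0 => triv_rep H
  | m'.+1 => tens_rep rho (tpow_rep m')
  end.

(* The intersection of the annihilators of all tensor powers *)
Definition tpow_ann (h : H) := forall m, tpow_rep m h = 0.

Definition invariant m (w : tpow m) :=
  forall h : H, tpow_rep m h w = (counit h : K) *: w.

End TensorPowers.

Definition least_positive (P : nat -> Prop) (m : nat) :=
  [/\ (0 < m)%N, P m & forall n, (0 < n)%N -> P n -> (m <= n)%N].

Definition is_order (K : fieldType) (H : hopfAlgType K) (V : vectType K)
    (rho : representation H V) :=
  least_positive (fun m => exists2 w, w != 0 & invariant rho (m := m) w).

(* h_(1) h_(2) ... h_(m), via h_(1) (h_(2) ... h_(m)) *)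
Fixpoint sweedler_pow (K : fieldType) (H : hopfAlgType K) (m : nat) (h : H) : H :=
  if m is m'.+1 then tlift (fun a b => a * sweedler_pow m' b) (comul h)
  else (counit h : K) *: 1.

Definition is_exponent (K : fieldType) (H : hopfAlgType K) :=
  least_positive (fun m =>
    forall h : H, sweedler_pow m h = (counit h : K) *: 1).

Definition hopf_ideal (K : fieldType) (H : hopfAlgType K) (J : H -> Prop) :=
  [/\ J 0 /\ (forall (a : K) x y, J x -> J y -> J (a *: x + y)),
      forall h x, J x -> J (h * x) /\ J (x * h),
      (* comul J is contained in J ⊗ H + H ⊗ J *)
      forall x, J x -> exists2 s : seq (H * H),
        comul x = \sum_(p <- s) tens p.1 p.2 &
        forall p, p \in s -> J p.1 \/ J p.2,
      forall x, J x -> counit x = 0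
    & forall x, J x -> J (antipode x)].

Definition hopf_morphism (K : fieldType) (H L : hopfAlgType K)
    (f : {lrmorphism H -> L}) :=
  [/\ forall h, comul (f h) = tmap f f (comul h),
      forall h, counit (f h) = counit h
    & forall h, antipode (f h) = f (antipode h)].

(* L, together with the projection f, is the quotient Hopf algebra H/J. *)
Definition is_hopf_quotient (K : fieldType) (H L : hopfAlgType K)
    (J : H -> Prop) (f : {lrmorphism H -> L}) :=
  [/\ hopf_morphism f, forall l, exists h, f h = l
    & forall h, f h = 0 <-> J h].

Section Characters.
Variables (K : fieldType) (L : hopfAlgType K).

Definition dual := 'Hom(L, K^o).

Definition lftrace (V : vectType K) (f : 'End(V)) : K^o :=
  \sum_i coord (vbasis {:V}) i (f (vbasis {:V})`_i).

Fact lftrace_is_linear (V : vectType K) : linear (@lftrace V).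
Proof.
move=> a f g; rewrite /lftrace scaler_sumr -big_split.
by apply: eq_bigr => i _; rewrite add_lfunE scale_lfunE linearP.
Qed.
HB.instance Definition _ (V : vectType K) :=
  GRing.isLinear.Build K 'End(V) K^o _ (@lftrace V) (@lftrace_is_linear V).

Definition character (V : vectType K) (rho : representation L V) : dual :=
  linfun (@lftrace V \o rho).

Lemma characterE V (rho : representation L V) h :
  character rho h = lftrace (rho h).
Proof. by rewrite lfunE. Qed.

Definition convolution (phi psi : dual) : dual :=
  linfun (tlift (fun a b => phi a * psi b : K^o) \o comul).

Lemma convolutionE phi psi h :
  convolution phi psi h = tlift (fun a b => phi a * psi b : K^o) (comul h).
Proof. by rewrite lfunE. Qed.

Definition irreducible_character (phi : dual) :=
  exists (W : vectType K) (sigma : representation L W),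
    irreducible sigma /\ phi = character sigma.

(* chi lists the irreducible characters, without repetition. *)
Definition irreducible_characters k (chi : 'I_k -> dual) :=
  injective chi /\
  forall phi, irreducible_character phi <-> exists i, phi = chi i.

(* A is the matrix of left multiplication by phi in the basis chi of the
   character ring; its entries are known to be nonnegative integers. *)
Definition left_mult_matrix k (chi : 'I_k -> dual) (phi : dual)
    (A : 'M[nat]_k) :=
  forall j, convolution phi (chi j) = \sum_i (A i j)%:R *: chi i.

End Characters.

Section Imprimitivity.
Variables (R : realType) (k : nat) (A : 'M[nat]_k).

Definition complex_mx : 'M[R[i]]_k := map_mx (fun n : nat => n%:R) A.

Definition perron_frobenius_eigenvalue (lambda : R[i]) :=
  [/\ 0 < lambda, eigenvalue complex_mx lambda
    & forall mu, eigenvalue complex_mx mu -> `|mu| <= lambda].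

(* [fset_set] sends a finite set to the corresponding fset. *)
Definition imprimitivity_index (lambda : R[i]) : nat :=
  #|` fset_set
        [set mu | eigenvalue complex_mx mu /\ `|mu| = lambda]%classic |%fset.

End Imprimitivity.

(* Main.v *)
(* Matrix coefficients of the tensor powers of V span a subalgebra of H^*, and
   the common annihilator J of the tensor powers is its orthogonal; this makes
   J a coideal. Convolution by the identity is an injective operator on End(H)
   preserving the maps that preserve J, hence so does its inverse, which maps
   the convolution unit to the antipode.

   The dimensions d_i of the simple H/J-modules form a positive left
   eigenvector of A, so lambda = dim V. If v is a left eigenvector with
   eigenvalue mu and |mu| = lambda, the equality case of the triangle
   inequality gives r_i = (mu / lambda) r_j for the ratios r_i = v_i / d_i
   whenever a_ij <> 0. Every simple module is reached from, and leads to, the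
   trivial one, so that these relations characterize the quotients mu / lambda:
   they form a finite group, and each of them has m-th power 1 as soon as the
   trivial module is a constituent of the m-th tensor power of V. This holds
   for m = ord(V) by definition. For m = exp(H), applying a coefficient f of V
   with f(1) <> 0 to h_(1) ... h_(m) = eps(h) 1 exhibits a multiple of eps as a
   coefficient of the m-th tensor power. *)

From HB Require Import structures.
Require Import Defs.
From mathcomp Require Import all_boot all_order all_algebra all_field.
From mathcomp Require Import ring cyclic finmap.
From mathcomp Require Import boolp classical_sets cardinality reals complex.

Set Implicit Arguments.
Unset Strict Implicit.
Unset Printing Implicit Defensive.

Import Order.TTheory GRing.Theory Num.Theory.
Local Open Scope ring_scope.

(** * Convolution and matrix coefficients *)

Lemma linear_tlift (K : fieldType) (U V : vectType K) (X Y : lmodType K)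
    (F : {linear X -> Y}) (f : U -> V -> X) t :
  F (tlift f t) = tlift (fun u v => F (f u v)) t.
Proof.
rewrite /tlift linear_sum; apply: eq_bigr => i _.
by rewrite linear_sum; apply: eq_bigr => j _; rewrite linearZ.
Qed.

Lemma tlift_sum (K : fieldType) (U V : vectType K) (X : lmodType K)
    (I : finType) (c : I -> K) (F : I -> U -> V -> X) t :
  tlift (fun u v => \sum_i c i *: F i u v) t = \sum_i c i *: tlift (F i) t.
Proof.
rewrite /tlift; under [RHS]eq_bigr do rewrite scaler_sumr.
rewrite [RHS]exchange_big; apply: eq_bigr => i _ /=.
under [RHS]eq_bigr do rewrite scaler_sumr.
rewrite [RHS]exchange_big; apply: eq_bigr => j _ /=.
by rewrite scaler_sumr; apply: eq_bigr => l _; rewrite !scalerA mulrC.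
Qed.

Lemma bilin_coord (K : fieldType) (U V : vectType K) (X : lmodType K)
    (f : U -> V -> X) u v :
  bilin f -> f u v = \sum_i \sum_j
    (coord (vbasis {:U}) i u * coord (vbasis {:V}) j v) *:
      f (vbasis {:U})`_i (vbasis {:V})`_j.
Proof.
move=> bf; rewrite -(tlift_tens bf); apply: eq_bigr => i _.
by apply: eq_bigr => j _; rewrite mxE.
Qed.

Lemma bilin_mul (K : fieldType) (U V : vectType K) (A : falgType K)
    (f : 'Hom(U, A)) (g : 'Hom(V, A)) :
  bilin (fun a b => f a * g b).
Proof.
split=> [v|u] a x y; first by rewrite linearP mulrDl -scalerAl.
by rewrite linearP mulrDr -scalerAr.
Qed.

Section Convolution.
Variables (K : fieldType) (H : hopfAlgType K).

Section Algebra.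
Variable A : falgType K.
Implicit Types f g h : 'Hom(H, A).

(** The target [A] is kept general: [A = K] gives the product of the dual algebra, [A = H] the
    setting in which the antipode is an inverse of the identity. *)
Definition conv f g : 'Hom(H, A) :=
  linfun (tlift (fun a b => f a * g b) \o comul).

Lemma convE f g x : conv f g x = tlift (fun a b => f a * g b) (comul x).
Proof. by rewrite lfunE. Qed.

Lemma convA f g h : conv (conv f g) h = conv f (conv g h).
Proof.
pose T q := tlift (fun b c => g b * h c) q.
pose Psi := tlift (fun a (q : H ⊗ H) => f a * T q).
have bPsi : bilin (fun a (q : H ⊗ H) => f a * T q).
  split=> [v|u] a x y; first by rewrite linearP mulrDl -scalerAl.
  by rewrite /T linearP mulrDr -scalerAr.
have [tl tr] := tens_bilin H H; have [ul ur] := tens_bilin H (H ⊗ H).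
have b3 (b : H) : bilin (fun u v : H => tens u (tens v b)).
  by split=> [v|u] a x y; rewrite (ul, tl) ?ur.
have bcomul : bilin (fun a b : H => tens (comul a) b).
  have [vl vr] := tens_bilin (H ⊗ H) H.
  by split=> [v|u] a x y; rewrite ?linearP ?vl ?vr.
have bcomur : bilin (fun a b : H => tens a (comul b)).
  by split=> [v|u] a x y; rewrite ?linearP ?ul ?ur.
have bas : bilin (fun (t : H ⊗ H) (w : H) =>
    tlift (fun u v => tens u (tens v w)) t).
  split=> [v|t] a x y; first by rewrite linearP.
  by rewrite -tlift_linear_fun; apply: tlift_ext => u v; rewrite tr ur.
apply/lfunP=> x; rewrite !convE.
(* [Psi] is the map a ⊗ (b ⊗ c) |-> f(a) g(b) h(c); the two sides of the claim are its values at the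
   two sides of coassociativity. *)
transitivity (Psi (tassoc (tmap comul idfun (comul x)))).
  elim/tensor_ind: (comul x) => [k s t Hs Ht|a b].
    by rewrite tlift_is_linear Hs Ht /Psi /tassoc /tmap !tlift_is_linear.
  rewrite tlift_tens; last exact: bilin_mul.
  rewrite /tmap tlift_tens // /tassoc tlift_tens // convE.
  elim/tensor_ind: (comul a) => [k s t Hs Ht|c d].
    by rewrite !tlift_is_linear mulrDl -scalerAl Hs Ht /Psi !tlift_is_linear.
  rewrite !tlift_tens //; last exact: bilin_mul.
  by rewrite /Psi tlift_tens // /T tlift_tens ?mulrA //; exact: bilin_mul.
rewrite comulA.
elim/tensor_ind: (comul x) => [k s t Hs Ht|a b].
  by rewrite tlift_is_linear -Hs -Ht /Psi /tmap !tlift_is_linear.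
rewrite tlift_tens; last exact: bilin_mul.
by rewrite /tmap tlift_tens // /Psi tlift_tens // convE.
Qed.

Definition eta_counit (x : H) : A := (counit x : K) *: 1.

Fact eta_counit_is_linear : linear eta_counit.
Proof. by move=> a x y; rewrite /eta_counit linearP scalerDl scalerA. Qed.
HB.instance Definition _ :=
  GRing.isLinear.Build K H A _ eta_counit eta_counit_is_linear.

Definition cunit : 'Hom(H, A) := linfun eta_counit.

Lemma cunitE x : cunit x = (counit x : K) *: 1.
Proof. by rewrite /cunit lfunE. Qed.

Lemma conv1 f : conv cunit f = f.
Proof.
apply/lfunP=> x; rewrite convE -[in RHS](counitl x) linear_tlift.
by apply: tlift_ext => a b; rewrite cunitE -scalerAl mul1r linearZ.
Qed.

Lemma conv_is_linear f : linear (conv f).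
Proof.
move=> a g h; apply/lfunP=> x; rewrite add_lfunE scale_lfunE !convE.
rewrite -tlift_linear_fun; apply: tlift_ext => b c.
by rewrite add_lfunE scale_lfunE mulrDr scalerAr.
Qed.

End Algebra.

Lemma convolution_conv (f g : dual H) : convolution f g = conv (A := K^o) f g.
Proof.
apply/lfunP=> x; rewrite convolutionE.
by have convE_x := @convE K^o f g x; symmetry.
Qed.

Lemma convolutionA (f g h : dual H) :
  convolution (convolution f g) h = convolution f (convolution g h).
Proof. by rewrite !convolution_conv convA. Qed.

(** The antipode is a left convolution inverse of the identity, so left convolution by the identity
    is injective on End(H). *)
Lemma conv_antipode_id (f : 'Hom(H, H)) :
  conv (linfun antipode) (conv \1%VF f) = f.
Proof.
rewrite -convA -[RHS]conv1; congr conv; apply/lfunP=> x.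
rewrite convE cunitE -antipodel; apply: tlift_ext => a b.
by rewrite lfunE id_lfunE.
Qed.

Lemma sweedler_powE m (x : H) :
  sweedler_pow m x = iter m (conv \1%VF) (cunit H : 'Hom(H, H)) x.
Proof.
elim: m x => [|m IHm] x /=; first by rewrite cunitE.
by rewrite convE; apply: tlift_ext => a b; rewrite id_lfunE IHm.
Qed.

End Convolution.

(** * Matrix coefficients of modules and of their tensor products *)

Section Coefficients.
Variables (K : fieldType) (H : hopfAlgType K).
Implicit Types f g : dual H.

(* [f] is a matrix coefficient of [rho], as a linear form vanishing on the
   kernel of [rho] factors through [rho]. *)
Definition coefficient (V : vectType K) (rho : representation H V) f :=
  forall x, rho x = 0 -> f x = 0.

(** Such a form does not distinguish [x] from the preimage of [rho x] chosen by the pseudo-inverse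
    of [rho]. *)
Lemma coefficient_factor V (rho : representation H V) f :
  coefficient rho f -> exists F : 'Hom('End(V), K^o), forall x, f x = F (rho x).
Proof.
move=> fP; exists (f \o (linfun rho)^-1)%VF => x; rewrite comp_lfunE.
apply/eqP; rewrite -subr_eq0; set y := (linfun rho)^-1%VF _.
have rhoE z : rho z = linfun rho z by rewrite lfunE.
have : f (x - y) = 0.
  by apply: fP; rewrite linearB /y !rhoE limg_lfunVK ?subrr // memv_img ?memvf.
by rewrite linearB => ->.
Qed.

Definition form_coef V (rho : representation H V)
    (F : {linear 'End(V) -> K^o}) : dual H := linfun (F \o rho).

Lemma form_coefE V (rho : representation H V) (F : {linear 'End(V) -> K^o}) x :
  form_coef rho F x = F (rho x).
Proof. by rewrite lfunE. Qed.

Lemma coefficient_form V (rho : representation H V)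
    (F : {linear 'End(V) -> K^o}) :
  coefficient rho (form_coef rho F).
Proof. by move=> x rx; rewrite form_coefE rx linear0. Qed.

Lemma rep_coefficientP V (rho : representation H V) x :
  (forall f, coefficient rho f -> f x = 0) -> rho x = 0.
Proof.
move=> fx; rewrite (coord_vbasis (memvf (rho x))) big1 // => i _.
have := fx _ (coefficient_form (rho := rho) (coord (vbasis fullv) i)).
by rewrite form_coefE => ->; rewrite scale0r.
Qed.

Lemma coefficient_sum V (rho : representation H V) (I : finType) (c : I -> K)
    (f : I -> dual H) :
  (forall i, coefficient rho (f i)) -> coefficient rho (\sum_i c i *: f i).
Proof.
move=> fP x rx; rewrite sum_lfunE big1 // => i _.
by rewrite scale_lfunE fP // scaler0.
Qed.

Lemma bilin_coefficient V W (rho : representation H V)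
    (sigma : representation H W) (b : 'End(V) -> 'End(W) -> K^o) :
  bilin b -> exists (I : finType) (f g : I -> dual H) (c : I -> K),
  [/\ forall i, coefficient rho (f i), forall i, coefficient sigma (g i)
    & forall x y, b (rho x) (sigma y) = \sum_i c i *: (f i x * g i y : K^o)].
Proof.
move=> bb; exists ('I_(\dim {:'End(V)}) * 'I_(\dim {:'End(W)}))%type.
exists (fun p => form_coef rho (coord (vbasis {:'End(V)}) p.1)).
exists (fun p => form_coef sigma (coord (vbasis {:'End(W)}) p.2)).
exists (fun p : 'I__ * 'I__ =>
  b (vbasis {:'End(V)})`_p.1 (vbasis {:'End(W)})`_p.2).
split=> [p|p|x y]; try exact: coefficient_form.
rewrite (bilin_coord _ _ bb) pair_bigA; apply: eq_bigr => p _ /=.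
by rewrite !form_coefE [LHS]mulrC.
Qed.

Definition rank1_fun (V : vectType K) (F : {linear V -> K^o}) (u v : V) : V :=
  (F v : K) *: u.

Fact rank1_fun_is_linear (V : vectType K) F u : linear (@rank1_fun V F u).
Proof. by move=> a x y; rewrite /rank1_fun linearP scalerDl scalerA. Qed.
HB.instance Definition _ (V : vectType K) F u :=
  GRing.isLinear.Build K V V _ (@rank1_fun V F u) (rank1_fun_is_linear F u).

(** Every operator X is the sum over j of the rank-one operators v |-> e_j^*(v) X(e_j); [phi j u] is
    the value of F at v |-> e_j^*(v) u. *)
Lemma End_form_sum (V : vectType K) (F : 'Hom('End(V), K^o)) :
  exists phi : 'I_(\dim {:V}) -> 'Hom(V, K^o),
    forall X, F X = \sum_j phi j (X (vbasis {:V})`_j).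
Proof.
pose rk1 j u : 'End(V) := linfun (rank1_fun (coord (vbasis {:V}) j) u).
have rk1E j u v : rk1 j u v = coord (vbasis {:V}) j v *: u.
  by rewrite lfunE.
have rk1_lin j : linear (rk1 j).
  move=> a u u'; apply/lfunP=> v; rewrite add_lfunE scale_lfunE !rk1E.
  by rewrite scalerDr !scalerA mulrC.
pose Rk j : {linear V -> 'End(V)} :=
  HB.pack (rk1 j) (GRing.isLinear.Build K V 'End(V) _ (rk1 j) (rk1_lin j)).
exists (fun j => linfun (F \o Rk j)) => X.
under eq_bigr => j _ do rewrite lfunE /=.
rewrite -linear_sum; congr (F _); apply/lfunP=> v.
rewrite sum_lfunE {1}(coord_vbasis (memvf v)) linear_sum.
by apply: eq_bigr => j _; rewrite linearZ rk1E.
Qed.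

(** The value at x is a sum of linear forms evaluated at the images of the basis tensors under the
    diagonal action of x, which are all zero when x acts by zero. *)
Lemma coefficient_tens V W (rho : representation H V)
    (sigma : representation H W) f g :
  coefficient rho f -> coefficient sigma g ->
  coefficient (tens_rep rho sigma) (convolution f g).
Proof.
move=> /coefficient_factor[F fE] /coefficient_factor[G gE].
have [phi phiE] := End_form_sum F; have [gam gamE] := End_form_sum G.
have bphi j l : bilin (fun u w => phi j u * gam l w : K^o).
  exact: (@bilin_mul _ _ _ K^o).
move=> x; rewrite /= /diag_act /= convolutionE => x0.
rewrite (_ : tlift _ _ = \sum_j \sum_l
   tlift (fun u w => phi j u * gam l w : K^o)
     (tlift (pair_act rho sigma) (comul x)
       (tens (vbasis {:V})`_j (vbasis {:W})`_l))); last first.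
  elim/tensor_ind: (comul x) => [k s t Hs Ht|a b].
    rewrite tlift_is_linear Hs Ht scaler_sumr -big_split; apply: eq_bigr => j _.
    rewrite /= scaler_sumr -big_split; apply: eq_bigr => l _ /=.
    by rewrite tlift_is_linear add_lfunE scale_lfunE tlift_is_linear.
  rewrite tlift_tens; last exact: (@bilin_mul _ _ _ K^o).
  rewrite fE gE phiE gamE mulr_suml; apply: eq_bigr => j _.
  rewrite mulr_sumr; apply: eq_bigr => l _.
  rewrite tlift_tens; last exact: pair_act_bilin.
  by rewrite pair_actE tlift_tens.
rewrite x0 big1 // => j _; rewrite big1 // => l _.
by rewrite zero_lfunE linear0.
Qed.

Lemma bilin_tmap (V W : vectType K) (X : lmodType K)
    (F : {linear 'End(V ⊗ W) -> X}) :
  bilin (fun (p : 'End(V)) (q : 'End(W)) => F (linfun (tmap p q))).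
Proof.
have [tl tr] := tens_bilin V W.
split=> [q|p] a x y; rewrite -linearP; congr (F _); apply: tens_lfunP => v w;
  rewrite add_lfunE scale_lfunE !lfunE /= !tmapE ?add_lfunE ?scale_lfunE;
  by rewrite ?tl ?tr.
Qed.

(** A form on End(V ⊗ W), restricted to the operators p ⊗ q, is bilinear in p and q, hence a sum of
    products of coefficients evaluated at x_(1) and x_(2). *)
Lemma coefficient_tens_sum V W (rho : representation H V)
    (sigma : representation H W) f :
  coefficient (tens_rep rho sigma) f ->
  exists (I : finType) (f1 f2 : I -> dual H) (c : I -> K),
  [/\ forall i, coefficient rho (f1 i), forall i, coefficient sigma (f2 i)
    & f = \sum_i c i *: convolution (f1 i) (f2 i)].
Proof.
move=> /coefficient_factor[F fE].
have [I [f1 [f2 [c [f1P f2P bE]]]]] :=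
  bilin_coefficient rho sigma (bilin_tmap F).
exists I, f1, f2, c; split=> //; apply/lfunP=> x.
rewrite fE /= /diag_act /= linear_tlift sum_lfunE.
under eq_bigr do rewrite scale_lfunE convolutionE.
by rewrite -tlift_sum; apply: tlift_ext; exact: bE.
Qed.

Lemma convolution_suml (I : finType) (c : I -> K) (f : I -> dual H) g :
  convolution (\sum_i c i *: f i) g = \sum_i c i *: convolution (f i) g.
Proof.
have lin_g : linear (fun f => convolution f g : dual H).
  move=> a f1 f2; apply/lfunP=> x.
  rewrite add_lfunE scale_lfunE !convolutionE -tlift_linear_fun.
  by apply: tlift_ext => b d; rewrite add_lfunE scale_lfunE mulrDl -scalerAl.
exact: (linear_sumZ c f lin_g).
Qed.

Lemma coefficient_triv f : coefficient (triv_rep H) f ->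
  forall x, f x = counit x * f 1.
Proof.
move=> fP x; have : f (x - (counit x : K) *: 1) = 0.
  apply: fP; rewrite /= /triv_act linearB linearZ /= counit1.
  by rewrite [_ *: 1]mulr1 subrr scale0r.
by rewrite linearB linearZ => /eqP; rewrite subr_eq0 => /eqP.
Qed.

Variables (V : vectType K) (rho : representation H V).

(** [tpow] adds one factor at a time, so the power m + n is not literally a tensor product of the
    powers m and n. Splitting off one factor of f and using the associativity of convolution avoids
    any isomorphism between these spaces. *)
Lemma coefficient_tpowD m n f g :
  coefficient (tpow_rep rho m) f -> coefficient (tpow_rep rho n) g ->
  coefficient (tpow_rep rho (m + n)) (convolution f g).
Proof.
elim: m f => [|m IHm] f fP gP.
  suff -> : convolution f g = f 1 *: g.
    by move=> x /gP gx; rewrite scale_lfunE gx scaler0.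
  apply/lfunP=> x; rewrite convolutionE scale_lfunE -[in RHS](counitl x).
  rewrite !linear_tlift.
  apply: tlift_ext => a b; rewrite (coefficient_triv fP).
  by rewrite linearZ [RHS]mulrA [counit a * _]mulrC.
have [I [f1 [f2 [c [f1P f2P ->]]]]] := coefficient_tens_sum fP.
rewrite convolution_suml; under eq_bigr do rewrite convolutionA.
by apply: coefficient_sum => i; apply: coefficient_tens => //; exact: IHm.
Qed.

Lemma tpow_annP x :
  tpow_ann rho x <-> forall m f, coefficient (tpow_rep rho m) f -> f x = 0.
Proof.
split=> [xJ m f fP|fx m]; first by apply: fP; exact: xJ.
by apply: rep_coefficientP => f; exact: fx.
Qed.

End Coefficients.

(** * The common annihilator of the tensor powers *)

(** A subspace of maximal dimension contained in P exhausts P, since otherwise a line could be added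
    to it. *)
Lemma vspace_of_pred (K : fieldType) (V : vectType K) (P : V -> Prop) :
  P 0 -> (forall (a : K) x y, P x -> P y -> P (a *: x + y)) ->
  exists U : {vspace V}, forall x, x \in U <-> P x.
Proof.
move=> P0 PD.
pose sub (U : {vspace V}) := forall x, x \in U -> P x.
pose Q n := `[< exists2 U, sub U & \dim U = n >].
have exQ : exists n, Q n.
  by exists 0%N; apply/asboolP; exists 0%VS; rewrite ?dimv0 // => x
    /[!memv0]/eqP->.
have boundQ n : Q n -> (n <= \dim {:V})%N.
  by move=> /asboolP[U _ <-]; rewrite dimvS ?subvf.
case: (ex_maxnP exQ boundQ) => _ /asboolP[U subU <-] maxU; exists U => x.
split=> [/subU//|Px].
have subUx : sub (U + <[x]>)%VS.
  move=> _ /memv_addP[u uU [_ /vlineP[a ->] ->]].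
  by rewrite addrC; apply: PD => //; exact: subU.
have /maxU leU : Q (\dim (U + <[x]>)) by apply/asboolP; exists (U + <[x]>)%VS.
have /eqP -> : U == (U + <[x]>)%VS by rewrite eqEdim addvSl.
by apply: subvP (addvSr _ _) _ (memv_line x).
Qed.

Section HopfIdeal.
Variables (K : fieldType) (H : hopfAlgType K).
Variables (V : vectType K) (rho : representation H V).

Lemma tpow_ann_space :
  tpow_ann rho 0 /\
  forall (a : K) x y,
    tpow_ann rho x -> tpow_ann rho y -> tpow_ann rho (a *: x + y).
Proof.
split=> [m|a x y xJ yJ m]; first by rewrite linear0.
by rewrite linearP /= xJ yJ scaler0 addr0.
Qed.

(** Finite-dimensional duality: a tensor orthogonal to all f ⊗ g, with f and g vanishing on J, lies
    in J ⊗ H + H ⊗ J. *)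
Lemma tpow_ann_tensor (t : H ⊗ H) :
  (forall m n f g,
     coefficient (tpow_rep rho m) f -> coefficient (tpow_rep rho n) g ->
     tlift (fun a b => f a * g b : K^o) t = 0) ->
  exists2 s : seq (H * H), t = \sum_(p <- s) tens p.1 p.2 &
    forall p, p \in s -> tpow_ann rho p.1 \/ tpow_ann rho p.2.
Proof.
move=> t0; have [J JE] := vspace_of_pred tpow_ann_space.1 tpow_ann_space.2.
(* The passage from coefficients to all forms vanishing on J replaces one factor at a time:
   contracting t with one form yields an element of J, because coefficients detect J. *)
have ortho (f g : dual H) : (forall x, x \in J -> f x = 0) ->
    (forall x, x \in J -> g x = 0) -> tlift (fun a b => f a * g b : K^o) t = 0.
  move=> fJ gJ.
  have cfg (c c' : dual H) : tlift (fun a b => c a * c' b : K^o) t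
      = c (tlift (fun a b => (c' b : K) *: a) t).
    by rewrite linear_tlift; apply: tlift_ext => a b; rewrite linearZ /= mulrC.
  have cfg' (c c' : dual H) : tlift (fun a b => c a * c' b : K^o) t
      = c' (tlift (fun a b => (c a : K) *: b) t).
    by rewrite linear_tlift; apply: tlift_ext => a b; rewrite linearZ.
  rewrite cfg'; apply/gJ/JE/tpow_annP => n c' c'P; rewrite -cfg' cfg.
  by apply/fJ/JE/tpow_annP => m c cP; rewrite -cfg; exact: t0 cP c'P.
(* The decomposition used is id ⊗ id = q ⊗ id + p ⊗ q + p ⊗ p. As p vanishes on J, the entries of (p
   ⊗ p)(t) are values of the kind covered by [ortho], hence zero. *)
pose q := projv J; pose p := (\1 - q)%VF.
have qJ x : tpow_ann rho (q x) by apply/JE; rewrite memv_proj.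
have pJ x : x \in J -> p x = 0.
  by move=> xJ; rewrite add_lfunE opp_lfunE id_lfunE projv_id ?subrr.
have qp x : x = q x + p x by rewrite add_lfunE opp_lfunE id_lfunE addrC subrK.
have pp0 : tmap p p t = 0.
  apply/matrixP=> i j; rewrite [RHS]mxE.
  pose cf i : {linear H -> K^o} := coord (vbasis {:H}) i.
  pose c i : dual H := (linfun (cf i) \o p)%VF.
  have cE k x : c k x = cf k (p x) by rewrite comp_lfunE lfunE.
  rewrite -(ortho (c i) (c j)); first last.
  - by move=> x /pJ px; rewrite cE px linear0.
  - by move=> x /pJ px; rewrite cE px linear0.
  rewrite /tmap /tlift summxE; apply: eq_bigr => k _.
  by rewrite summxE; apply: eq_bigr => l _; rewrite !mxE !cE.
pose e (i : 'I_(\dim {:H})) := (vbasis {:H})`_i.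
pose r := index_enum ('I_(\dim {:H}) * 'I_(\dim {:H}))%type.
exists ([seq (t u.1 u.2 *: q (e u.1), e u.2) | u <- r] ++
        [seq (t u.1 u.2 *: p (e u.1), q (e u.2)) | u <- r]); last first.
  move=> u; rewrite mem_cat => /orP[] /mapP[v _ ->] /=; last by right.
  by left; rewrite -[_ *: _]addr0; apply: tpow_ann_space.2 => //;
     exact: tpow_ann_space.1.
have [tl tr] := tens_bilin H H.
have tZ a (x y : H) : tens (a *: x) y = a *: tens x y.
  by have := tl y a x 0; rewrite /= addr0 => ->;
     rewrite [tens 0 _](_ : _ = 0) ?addr0 //;
     apply/matrixP=> i j; rewrite !mxE linear0 mul0r.
have tDl (x x' y : H) : tens (x + x') y = tens x y + tens x' y.
  by have := tl y 1 x x'; rewrite /= !scale1r.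
have tDr (x y y' : H) : tens x (y + y') = tens x y + tens x y'.
  by have := tr x 1 y y'; rewrite /= !scale1r.
rewrite big_cat /= !big_map -big_split /= -[LHS]subr0 -[X in _ - X]pp0.
rewrite {1}(tens_span t) /tmap /tlift.
rewrite !pair_bigA -sumrB; apply: eq_bigr => -[i j] _ /=.
rewrite -/(e i) -/(e j) !tZ -scalerBr -scalerDr; congr (_ *: _).
by rewrite {1}(qp (e i)) tDl {2}(qp (e j)) tDr addrA addrK.
Qed.

Lemma tpow_ann_hopf_ideal : hopf_ideal (tpow_ann rho).
Proof.
have [JE0 JD] := tpow_ann_space.
have idl h x : tpow_ann rho x -> tpow_ann rho (h * x).
  by move=> xJ m; rewrite repM xJ comp_lfun0r.
have idr h x : tpow_ann rho x -> tpow_ann rho (x * h).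
  by move=> xJ m; rewrite repM xJ comp_lfun0l.
have coid x : tpow_ann rho x -> exists2 s : seq (H * H),
    comul x = \sum_(p <- s) tens p.1 p.2 &
    forall p, p \in s -> tpow_ann rho p.1 \/ tpow_ann rho p.2.
  move=> xJ; apply: tpow_ann_tensor => m n f g fP gP.
  rewrite -convolutionE.
  by apply: ((tpow_annP rho x).1 xJ (m + n)%N); exact: coefficient_tpowD.
have counit0 x : tpow_ann rho x -> counit x = 0.
  move=> /(_ 0%N) /lfunP/(_ 1).
  by rewrite /= /triv_act scale_lfunE id_lfunE zero_lfunE [_ *: _]mulr1.
split=> //; first by move=> h x xJ; split; [exact: idl | exact: idr].
have [J JE] := vspace_of_pred JE0 JD.
(* [X] is the space of endomorphisms preserving J, and [T] is left convolution by the identity.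
   Being injective and mapping [X] into itself, [T] maps it onto itself by finite dimension. *)
pose stab f := forall x, x \in J -> (f : 'End(H)) x \in J.
have [|a f g fJ gJ x xJ|X XE] := @vspace_of_pred _ _ stab.
- by move=> x _; rewrite zero_lfunE mem0v.
- by rewrite add_lfunE scale_lfunE memvD ?memvZ ?fJ ?gJ.
pose T : {linear 'End(H) -> 'End(H)} := HB.pack (@conv _ H H \1%VF)
  (GRing.isLinear.Build K 'End(H) 'End(H) _ _ (@conv_is_linear _ H H \1%VF)).
have TX f : f \in X -> T f \in X.
  move=> /XE fX; apply/XE=> x /JE/coid[s sE sJ].
  rewrite /= convE sE linear_sum big_seq; apply: memv_suml => u /sJ uJ.
  rewrite /= tlift_tens; last exact: bilin_mul.
  rewrite id_lfunE; apply/JE.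
  by case: uJ => [|/JE/fX/JE]; [exact: idr | exact: idl].
have Tker : lker (linfun T) == 0%VS.
  apply/lker0P=> f g; rewrite !lfunE /= => /(congr1 (conv (linfun antipode))).
  by rewrite !conv_antipode_id.
have TXE : (linfun T @: X)%VS = X.
  apply/eqP; rewrite eqEdim limg_dim_eq ?leqnn ?andbT; last first.
    by rewrite (eqP Tker) capv0.
  by apply/subvP=> _ /memv_imgP[f fX ->]; rewrite lfunE; exact: TX.
have uX : (@cunit _ H H : 'End(H)) \in X.
  by apply/XE => x /JE/counit0 x0; rewrite cunitE x0 scale0r mem0v.
(* The convolution unit preserves J because the counit vanishes there; its preimage [S] under [T]
   must be the antipode. *)
move: uX; rewrite -TXE => /memv_imgP[S SX uE].
have SE : S = linfun antipode.
  rewrite -[LHS](conv_antipode_id S) -[conv \1%VF S]/(T S).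
  have -> : T S = @cunit _ H H by rewrite uE lfunE.
  apply/lfunP=> x.
  rewrite convE -[in RHS](counitr x) linear_tlift; apply: tlift_ext => a b.
  by rewrite cunitE -scalerAr mulr1 linearZ.
move=> x /JE xJ; apply/JE; have := (XE S).1 SX x xJ.
by rewrite SE lfunE.
Qed.

End HopfIdeal.

(** * Traces, characters and idempotents *)

Lemma natr_inj_pchar0 (K : fieldType) : [pchar K] =i pred0 ->
  injective (fun n : nat => n%:R : K).
Proof.
move=> charK m n /eqP mn; wlog le_mn: m n mn / (m <= n)%N.
  by move=> IH; have [/IH->|/ltnW/IH-> //] := leqP m n; rewrite // eq_sym.
move: mn; rewrite eq_sym -subr_eq0 -natrB // ((pcharf0P K).1 charK) subn_eq0.
by move=> le_nm; apply/eqP; rewrite eqn_leq le_mn.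
Qed.

Section Trace.
Variable K : fieldType.
Implicit Types V W : vectType K.

(** The trace can be read off any expression of f as a sum of rank-one operators; the [b i] need not
    form a basis. *)
Lemma lftrace_sum V (f : 'End(V)) (I : finType) (c : I -> {linear V -> K^o})
    (b : I -> V) :
  (forall v, f v = \sum_i (c i v : K) *: b i) -> lftrace f = \sum_i c i (b i).
Proof.
move=> fE; rewrite /lftrace.
under eq_bigr => j _ do rewrite fE linear_sum.
rewrite exchange_big; apply: eq_bigr => i _ /=.
rewrite [in RHS](coord_vbasis (memvf (b i))) linear_sum; apply: eq_bigr => j _.
by rewrite !linearZ /= [LHS]mulrC.
Qed.

Lemma lftrace1 V : lftrace (\1%VF : 'End(V)) = (\dim {:V})%:R.
Proof.
rewrite /lftrace -[in RHS](card_ord (\dim {:V})) -sumr_const.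
apply: eq_bigr => i _.
by rewrite id_lfunE coord_free ?(basis_free (vbasisP _)) // eqxx.
Qed.

Definition tens_entry V W i j (t : V ⊗ W) : K^o := t i j.
Fact tens_entry_is_linear V W i j : linear (@tens_entry V W i j).
Proof. by move=> a s t; rewrite /tens_entry !mxE. Qed.
HB.instance Definition _ V W i j :=
  GRing.isLinear.Build K (V ⊗ W) K^o _ (@tens_entry V W i j)
    (@tens_entry_is_linear V W i j).

Lemma lftrace_tmap V W (f : 'End(V)) (g : 'End(W)) :
  lftrace (linfun (tmap f g)) = lftrace f * lftrace g.
Proof.
rewrite (@lftrace_sum _ _ ('I_(\dim {:V}) * 'I_(\dim {:W}))%type
  (fun p => @tens_entry V W p.1 p.2)
  (fun p => tens (f (vbasis {:V})`_p.1) (g (vbasis {:W})`_p.2))); last first.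
  move=> t; rewrite lfunE /= /tmap /tlift pair_bigA.
  by apply: eq_bigr => p _.
rewrite /lftrace big_distrlr pair_bigA; apply: eq_bigr => p _ /=.
by rewrite /tens_entry mxE.
Qed.

Lemma lftrace_conj V W (f : 'End(V)) (g : 'End(W)) (u : 'Hom(V, W)) :
  lker u = 0%VS -> limg u = fullv -> (forall v, u (f v) = g (u v)) ->
  lftrace f = lftrace g.
Proof.
move=> ku iu uf.
pose c i : {linear W -> K^o} := coord (vbasis {:V}) i \o u^-1%VF.
rewrite (@lftrace_sum _ g _ c (fun i => u (f (vbasis {:V})`_i))) => [|w].
  by apply: eq_bigr => i _; rewrite /c /= lker0_lfunK // ku.
rewrite -[in LHS](limg_lfunVK (f := u) (x := w)) ?iu ?memvf // -uf.
rewrite [in LHS](coord_vbasis (memvf (u^-1%VF w))) !linear_sum.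
by apply: eq_bigr => i _; rewrite !linearZ.
Qed.

(** Expanding p in a basis of its image shows that its trace is its rank, which is zero in K only if
    it is zero. *)
Lemma lftrace_idem V (p : 'End(V)) :
  [pchar K] =i pred0 -> (p \o p)%VF = p -> lftrace p = 0 -> p = 0.
Proof.
move=> charK pp; pose c i : {linear V -> K^o} := coord (vbasis (limg p)) i \o p.
have pb v : v \in limg p -> p v = v.
  by case/memv_imgP=> u _ ->; rewrite -comp_lfunE pp.
rewrite (@lftrace_sum _ p _ c (fun i => (vbasis (limg p))`_i)) => [|v];
    last first.
  by rewrite {1}(coord_vbasis (memv_img p (memvf v))).
under eq_bigr => i _.
  rewrite /c /= pb ?vbasis_mem ?mem_nth ?size_tuple //.
  rewrite coord_free ?(basis_free (vbasisP _)) // eqxx.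
  over.
rewrite sumr_const card_ord => /eqP; rewrite ((pcharf0P K).1 charK).
rewrite dimv_eq0 => /eqP p0; apply/lfunP=> v; apply/eqP.
by rewrite zero_lfunE -memv0 -p0 memv_img ?memvf.
Qed.

End Trace.

(** * Characters and simple modules of a Hopf algebra *)

Section Modules.
Variables (K : fieldType) (L : hopfAlgType K).
Implicit Types V W : vectType K.

Lemma character_tens V W (rho : representation L V)
    (sigma : representation L W) :
  character (tens_rep rho sigma) =
    convolution (character rho) (character sigma).
Proof.
apply/lfunP=> x; rewrite characterE convolutionE /= /diag_act /= linear_tlift.
by apply: tlift_ext => a b; rewrite !characterE -lftrace_tmap.
Qed.

Lemma character1 V (rho : representation L V) :
  character rho 1 = (\dim {:V})%:R.
Proof. by rewrite characterE rep1 lftrace1. Qed.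

Lemma dim_regular : \dim {:K^o} = 1%N.
Proof. by rewrite dimvf. Qed.

Lemma character_triv x : character (triv_rep L) x = counit x.
Proof.
by rewrite characterE /= /triv_act linearZ /= lftrace1 dim_regular;
   exact: mulr1.
Qed.

Lemma irreducible_triv : irreducible (triv_rep L).
Proof.
split=> [|U _]; first by rewrite -dimv_eq0 dim_regular.
have := dimvS (subvf U); rewrite dim_regular leq_eqVlt ltnS leqn0 dimv_eq0.
case/orP=> /eqP; last by left.
by move=> U1; right; apply/eqP; rewrite eqEdim subvf dim_regular U1.
Qed.

Definition act_on V (rho : representation L V) (v : V) (x : L) : V := rho x v.
Fact act_on_is_linear V (rho : representation L V) v : linear (act_on rho v).
Proof. by move=> a x y; rewrite /act_on linearP add_lfunE scale_lfunE. Qed.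
HB.instance Definition _ V (rho : representation L V) v :=
  GRing.isLinear.Build K L V _ (act_on rho v) (act_on_is_linear rho v).

(** Only stability of the image is required, so that W may be L itself without being packaged as a
    representation. *)
Lemma irreducible_img V W (rho : representation L V) (f : 'Hom(W, V)) :
  irreducible rho -> f != 0 ->
  (forall a w, exists w', rho a (f w) = f w') -> limg f = fullv.
Proof.
move=> [_ irr] f0 fP; case: (irr (limg f)) => // [a|img0].
  apply/subvP=> _ /memv_imgP[_ /memv_imgP[w _ ->] ->].
  by have [w' ->] := fP a w; rewrite memv_img ?memvf.
case/eqP: f0; apply/lfunP=> w; apply/eqP.
by rewrite zero_lfunE -memv0 -img0 memv_img ?memvf.
Qed.

(* The idempotent generates a complement of the maximal left ideal
   annihilating a vector of the given simple module, a minimal left ideal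
   isomorphic to that module. *)
Lemma irreducible_idempotent (ssL : semisimple L) V (rho : representation L V) :
  irreducible rho -> exists e : L, [/\ e * e = e, rho e != 0 &
    forall W (sigma : representation L W), irreducible sigma ->
      sigma e != 0 -> character sigma = character rho].
Proof.
move=> irr; have V0 := irr.1; pose v := vpick {:V}.
have v0 : v != 0 by rewrite vpick0.
pose F := linfun (act_on rho v); have FE x : F x = rho x v by rewrite lfunE.
have F1 : F 1 = v by rewrite FE rep1 id_lfunE.
have Fimg : limg F = fullv.
  apply: irreducible_img irr _ _ => [|a w].
    by apply: contraNneq v0 => F0; rewrite -F1 F0 zero_lfunE.
  by exists (a * w); rewrite !FE repM comp_lfunE.
have idM : ({:L} * lker F <= lker F)%VS.
  apply/prodvP=> a x _; rewrite !memv_ker !FE repM comp_lfunE => /eqP->.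
  by rewrite linear0.
have [M' [/prodvP idM' ML MM']] := ssL _ idM; move/prodvP: idM => idM.
have /memv_addP[e1 e1M [e eM' e1e]] : 1 \in (lker F + M')%VS.
  by rewrite ML memvf.
have MM0 x : x \in lker F -> x \in M' -> x = 0.
  by move=> xM xM'; apply/eqP; rewrite -memv0 -MM' memv_cap xM.
(* [e - e * e] equals [e * e1], so it lies in [lker F] as well as in the complement [M']. *)
have ee : e * e = e.
  apply/esym/eqP; rewrite -subr_eq0; apply/eqP/MM0; last first.
    by rewrite memvB // idM' ?memvf.
  by rewrite -{1}[e]mulr1 -mulrBr e1e addrK idM ?memvf.
have ev : rho e v = v.
  move: e1M; rewrite memv_ker FE => /eqP e1v.
  by rewrite -[RHS]F1 e1e FE linearD add_lfunE e1v add0r.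
exists e; split=> // [|W sigma irrS se0].
  by apply: contraNneq v0 => re; rewrite -ev re zero_lfunE.
have [w sew] : exists w, sigma e w != 0.
  apply: contrapT => se; case/eqP: se0; apply/lfunP=> w; rewrite zero_lfunE.
  by apply: contrapT => /eqP sew; apply: se; exists w.
pose G := linfun (act_on sigma (sigma e w)).
have GE x : G x = sigma x (sigma e w) by rewrite lfunE.
(* [u] sends [rho x v] to [sigma x (sigma e w)]. This is well defined: if x kills v, then x e lies
   in both complementary left ideals because [rho e v = v], so x e = 0. *)
pose u := (G \o F^-1)%VF.
have uF x : u (F x) = G x.
  rewrite comp_lfunE; set y := (F^-1)%VF _.
  have yx : y - x \in lker F.
    have Fy : F y = F x by rewrite limg_lfunVK ?memv_img ?memvf.
    by rewrite memv_ker linearB /= Fy subrr.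
  have yxe : (y - x) * e = 0.
    apply: MM0; last by rewrite idM' ?memvf.
    by move: yx; rewrite !memv_ker !FE repM comp_lfunE ev.
  have : G (y - x) = 0 by rewrite GE -comp_lfunE -repM yxe linear0 zero_lfunE.
  by rewrite linearB => /eqP; rewrite subr_eq0 => /eqP.
have Fsurj w' : exists x, w' = F x.
  by have := memvf w'; rewrite -Fimg => /memv_imgP[x _ ->]; exists x.
have urho a w' : u (rho a w') = sigma a (u w').
  have [x ->] := Fsurj w'; have -> : rho a (F x) = F (a * x).
    by rewrite !FE repM comp_lfunE.
  by rewrite !uF !GE repM comp_lfunE.
have uv : u v = sigma e w.
  by rewrite -F1 uF GE rep1 id_lfunE.
apply/lfunP=> x; rewrite !characterE; apply/esym.
apply: (@lftrace_conj _ _ _ _ _ u) => //; last first.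
  apply: irreducible_img irrS _ _ => [|a w'].
    by apply: contraNneq sew => u0; rewrite -uv u0 zero_lfunE.
  by exists (rho a w'); rewrite urho.
case: (irr.2 (lker u)) => // [a|kuf].
  apply/subvP=> _ /memv_imgP[w' kw' ->].
  by move: kw'; rewrite !memv_ker urho => /eqP->; rewrite linear0.
by case/eqP: sew; apply/eqP; rewrite -uv -memv_ker kuf memvf.
Qed.

End Modules.

(** A complement of the preimage of a left ideal maps onto a complement of that ideal. *)
Lemma semisimple_quotient (K : fieldType) (A B : falgType K)
    (f : {lrmorphism A -> B}) :
  (forall b, exists a, f a = b) -> semisimple A -> semisimple B.
Proof.
move=> fs ssA I /prodvP idI; pose F := linfun f.
have FE a : F a = f a by rewrite lfunE.
have [|I' [/prodvP idI' IA II']] := ssA (F @^-1: I)%VS.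
  apply/prodvP=> a x _; rewrite -!memv_preim !FE rmorphM => xI.
  by rewrite idI ?memvf.
exists (F @: I')%VS; split.
- apply/prodvP=> b _ _ /memv_imgP[x xI' ->]; have [a <-] := fs b.
  have -> : f a * F x = F (a * x) by rewrite !FE rmorphM.
  by rewrite memv_img // idI' ?memvf.
- apply/eqP; rewrite eqEsubv subvf /=; apply/subvP=> b _; have [a <-] := fs b.
  have /memv_addP[x xI [y yI' ->]] : a \in (F @^-1: I + I')%VS.
    by rewrite IA memvf.
  by rewrite -FE linearD /= memv_add ?memv_img // memv_preim.
apply/eqP; rewrite -subv0; apply/subvP=> b /memv_capP[bI /memv_imgP[x xI' bE]].
suff x0 : x = 0 by rewrite bE x0 linear0 mem0v.
by apply/eqP; rewrite -memv0 -II' memv_cap xI' andbT -memv_preim -bE.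
Qed.

(** * Eigenvalues of maximal modulus *)

(* Arrows lead from columns to rows: from [l] to [i] when [A i l != 0]. *)
Fixpoint walk k (A : 'M[nat]_k) (m : nat) (j i : 'I_k) : Prop :=
  if m is m'.+1 then exists2 l, walk A m' j l & A i l != 0%N else i = j.

Section PerronFrobenius.
Variables (C : numClosedFieldType) (k : nat) (A : 'M[nat]_k).
Let M : 'M[C]_k := map_mx (fun n : nat => n%:R) A.

(* For [z] of modulus 1, such an [r] is what remains of an eigenvector of
   maximal modulus once its entries are divided by the dimensions. *)
Definition phase (z : C) (r : 'I_k -> C) :=
  (forall j, r j != 0) /\ forall i j, A i j != 0%N -> r i = z * r j.

Lemma phase_walk z r m i j : phase z r -> walk A m j i -> r i = z ^+ m * r j.
Proof.
move=> [_ rA]; elim: m i => [|m IHm] i /=; first by move=> ->; rewrite mul1r.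
by case=> l /IHm rl /rA ->; rewrite rl exprS mulrA.
Qed.

Lemma phaseM z1 z2 r1 r2 : phase z1 r1 -> phase z2 r2 ->
  phase (z1 * z2) (fun i => r1 i * r2 i).
Proof.
move=> [nz1 r1A] [nz2 r2A]; split=> [j|i j Aij].
  by rewrite mulf_neq0 ?nz1 ?nz2.
by rewrite (r1A _ _ Aij) (r2A _ _ Aij) mulrACA.
Qed.

Variables (n : nat) (d : 'I_k -> nat) (o : 'I_k).
Hypothesis n_gt0 : (0 < n)%N.
Hypothesis d_gt0 : forall i, (0 < d i)%N.
Hypothesis dA : forall j, (\sum_i A i j * d i = n * d j)%N.
Hypothesis to_o : forall j, exists m, walk A m j o.
Hypothesis from_o : forall j, exists m, walk A m o j.

Let nC_gt0 : 0 < n%:R :> C. Proof. by rewrite ltr0n. Qed.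
Let nC_neq0 : n%:R != 0 :> C. Proof. by rewrite gt_eqF. Qed.
Let dC_gt0 i : 0 < (d i)%:R :> C. Proof. by rewrite ltr0n. Qed.
Let dC_neq0 i : (d i)%:R != 0 :> C. Proof. by rewrite gt_eqF. Qed.

Let sum_weight j : \sum_i (A i j * d i)%:R = n%:R * (d j)%:R :> C.
Proof. by rewrite -natr_sum dA natrM. Qed.

(** The row with entries d_i r_i is a left eigenvector. *)
Lemma phase_eigenvalue z r : phase z r -> eigenvalue M (z * n%:R).
Proof.
move=> [r0 rA]; apply/eigenvalueP; exists (\row_i ((d i)%:R * r i)).
  apply/rowP=> j; rewrite !mxE.
  transitivity (\sum_i (A i j * d i)%:R * (z * r j)).
    apply: eq_bigr => i _; rewrite !mxE natrM.
    have [->|Aij] := eqVneq (A i j) 0%N; first by rewrite mulr0 !mul0r.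
    by rewrite (rA _ _ Aij); ring.
  by rewrite -mulr_suml sum_weight; ring.
apply/eqP=> /rowP/(_ o)/eqP; rewrite !mxE mulf_eq0.
by rewrite (negPf (dC_neq0 o)) (negPf (r0 o)).
Qed.

Lemma eigenvalue_ratio mu : eigenvalue M mu ->
  exists r : 'I_k -> C,
    (forall j, \sum_i (A i j * d i)%:R * r i = mu * (d j)%:R * r j) /\
    exists2 j0, r j0 != 0 & forall i, `|r i| <= `|r j0|.
Proof.
case/eigenvalueP=> v vM v0; exists (fun i => v 0 i / (d i)%:R); split=> [j|].
  have /rowP/(_ j) := vM; rewrite !mxE => vMj.
  rewrite -mulrA [_ * (_ / _)]mulrC divfK // -vMj; apply: eq_bigr => i _.
  by rewrite !mxE natrM; field.
have [j0 _ maxj] := @real_arg_maxP _ _ o predT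
  (fun i => `|v 0 i / (d i)%:R|) isT (fun i _ => normr_real _).
exists j0 => [|i]; last exact: maxj.
apply: contra v0 => /eqP r0; apply/eqP/rowP=> i; rewrite mxE.
have : `|v 0 i / (d i)%:R| <= `|v 0 j0 / (d j0)%:R| := maxj i isT.
rewrite r0 normr0 normr_le0 mulf_eq0 invr_eq0 (negPf (dC_neq0 i)).
by rewrite orbF => /eqP.
Qed.

(** The triangle inequality is applied to the eigenvector equation at an index where the ratio v_i /
    d_i has maximal modulus. *)
Lemma eigenvalue_le mu : eigenvalue M mu -> `|mu| <= n%:R.
Proof.
case/eigenvalue_ratio=> r [rE [j0 r0 maxr]].
rewrite -(@ler_pM2r _ ((d j0)%:R * `|r j0|)); last first.
  by rewrite mulr_gt0 ?normr_gt0.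
rewrite !mulrA -[X in _ * X * _](ger0_norm (ltW (dC_gt0 j0))) -!normrM -rE.
rewrite -sum_weight mulr_suml (le_trans (ler_norm_sum _ _ _)) //.
apply: ler_sum => i _.
by rewrite normrM ger0_norm ?ler0n // ler_wpM2l ?ler0n.
Qed.

Lemma eigenvalue_phase mu : eigenvalue M mu -> `|mu| = n%:R ->
  exists r, phase (mu / n%:R) r.
Proof.
move=> /eigenvalue_ratio[r [rE [j0 r0 maxr]]] mu_n.
pose z := mu / n%:R; have z1 : `|z| = 1.
  by rewrite normrM normfV mu_n ger0_norm ?ler0n // divff.
have z0 : z != 0 by rewrite -normr_eq0 z1 oner_eq0.
(* After division by [z * r j], the terms of the eigenvector equation are bounded in modulus by the
   weights a_ij d_i and have the same sum, so each term equals its weight. *)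
have step i j : `|r j| = `|r j0| -> A i j != 0%N -> r i = z * r j.
  move=> rj Aij; have rj0 : r j != 0 by rewrite -normr_eq0 rj normr_eq0.
  have zr0 : z * r j != 0 by rewrite mulf_neq0.
  have := @normC_sum_upper _ _ predT
    (fun i => (A i j * d i)%:R * r i / (z * r j))
    (fun i => (A i j * d i)%:R) _ _ i isT.
  rewrite -mulr_suml rE sum_weight => /(_ _ _)/wrap[] => [l _||].
  - rewrite -mulrA normrM ger0_norm ?ler0n // ler_piMr ?ler0n //.
    by rewrite normrM normfV normrM z1 mul1r rj ler_pdivrMr ?normr_gt0 // mul1r.
  - rewrite /z; field; rewrite rj0 nC_neq0 /=.
    by rewrite -normr_eq0 mu_n nC_neq0.
  move/(congr1 ( *%R^~ (z * r j))); rewrite divfK //.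
  apply: mulfI; rewrite pnatr_eq0 muln_eq0 negb_or Aij -lt0n; exact: d_gt0.
(* Maximality of the modulus spreads along walks, first from [j0] to [o] and then from [o] to every
   index. *)
have walkr m j i : `|r j| = `|r j0| -> walk A m j i -> `|r i| = `|r j0|.
  move=> rj; elim: m i => [|m IHm] i /=; first by move=> ->.
  by case=> l /IHm rl Ail; rewrite (step _ _ rl Ail) normrM z1 mul1r.
have ro : `|r o| = `|r j0| by have [m] := to_o j0; exact: walkr.
have rj j : `|r j| = `|r j0| by have [m] := from_o j; exact: walkr.
exists r; split=> [j|i j]; last exact: step.
by rewrite -normr_eq0 rj normr_eq0.
Qed.

End PerronFrobenius.

(** Multiplication by x permutes s, and comparing the products of all elements gives x ^+ size s =
    1. Hence s consists of size s distinct roots of unity of that order and contains a primitive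
    one, whose m-th power is 1. *)
Lemma size_mul_closed_dvd (F : fieldType) (s : seq F) m :
  uniq s -> (0 < size s)%N -> {in s &, forall x y, x * y \in s} ->
  {in s, forall x, x ^+ m = 1} -> {in s, forall x, x != 0} -> (size s %| m)%N.
Proof.
move=> us s_gt0 sM sm s0.
have sU : all (size s).-unity_root s.
  apply/allP=> x xs; rewrite unity_rootE.
  have sx : perm_eq [seq x * y | y <- s] s.
    have uxs : uniq [seq x * y | y <- s].
      by rewrite map_inj_uniq //; apply/mulfI/s0.
    have subs : {subset [seq x * y | y <- s] <= s}.
      by move=> _ /mapP[y ys ->]; exact: sM.
    have [|_ eqs] := uniq_min_size uxs subs; first by rewrite size_map.
    exact: uniq_perm.
  have := perm_big _ sx (op := *%R) (x := 1) (P := predT) (F := id).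
  rewrite big_map big_split /= big_const_seq count_predT -Monoid.iteropE /=.
  have p0 : \prod_(y <- s) y != 0 by rewrite prodf_seq_neq0; apply/allP=> y /s0.
  by rewrite -[RHS]mul1r => /(mulIf p0) xs1; apply/eqP.
have /hasP[z zs zprim] := has_prim_root s_gt0 sU us (leqnn _).
by rewrite (prim_order_dvd zprim) sm.
Qed.

Lemma imprimitivity_index_dvd (R : realType) k (A : 'M[nat]_k) (lambda : R[i])
    (n : nat) (d : 'I_k -> nat) (o : 'I_k) m :
  (0 < n)%N -> (forall i, (0 < d i)%N) ->
  (forall j, (\sum_i A i j * d i = n * d j)%N) ->
  (forall j, exists m, walk A m j o) -> (forall j, exists m, walk A m o j) ->
  perron_frobenius_eigenvalue A lambda -> walk A m o o ->
  (imprimitivity_index A lambda %| m)%N.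
Proof.
move=> n0 d0 dA to_o from_o [lambda0 lambdaA max_lambda] oo.
have nC0 : n%:R != 0 :> R[i] by rewrite pnatr_eq0 -lt0n.
(* n bounds every eigenvalue, and it is itself an eigenvalue, with the constant phase 1. *)
have lambdaE : lambda = n%:R.
  apply/eqP; rewrite eq_le -{1}(gtr0_norm lambda0) (eigenvalue_le o d0 dA) //=.
  have /max_lambda : eigenvalue (complex_mx R A) n%:R.
    rewrite -[n%:R]mul1r; apply: (phase_eigenvalue (r := fun=> 1) o d0 dA).
    by split=> [j|i j _]; rewrite ?oner_eq0 ?mul1r.
  by rewrite ger0_norm ?ler0n.
rewrite /imprimitivity_index; set S := mkset _.
(* Finiteness is needed for [fset_set S] to have the elements of [S]; the eigenvalues are the roots
   of the nonzero characteristic polynomial. *)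
have Sfin : finite_set S.
  have [s sE] := closed_field_poly_normal (char_poly (complex_mx R A)).
  apply: sub_finite_set (finite_seq s) => mu [+ _] /=.
  rewrite eigenvalue_root_char sE rootZ ?root_prod_XsubC //.
  by rewrite lead_coef_eq0 -size_poly_eq0 size_char_poly.
have memS mu : mu \in enum_fset (fset_set S) <->
    eigenvalue (complex_mx R A) mu /\ `|mu| = lambda.
  have -> : (mu \in enum_fset (fset_set S)) = (mu \in S) by exact: in_fset_set.
  by split=> [/set_mem|?]; last exact: mem_set.
pose s := [seq mu / n%:R | mu <- enum_fset (fset_set S)].
have sP z : z \in s <-> exists r, phase A z r /\ `|z| = 1.
  split=> [/mapP[mu /memS[muA mu1] ->]|[r [rz z1]]].
    have [|r rP] := eigenvalue_phase n0 d0 dA to_o from_o muA.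
      by rewrite mu1.
    exists r; split=> //.
    by rewrite normrM normfV mu1 lambdaE ger0_norm ?ler0n // divff.
  apply/mapP; exists (z * n%:R); last by rewrite mulfK.
  apply/memS; split; first exact: phase_eigenvalue o d0 dA _ _ rz.
  by rewrite normrM z1 mul1r lambdaE ger0_norm ?ler0n.
have szs : size s = #|` fset_set S|%fset by rewrite size_map cardfE -cardfE.
rewrite -szs; apply: size_mul_closed_dvd.
- rewrite map_inj_uniq ?fset_uniq //; by apply/mulIf; rewrite invr_eq0.
- rewrite size_map; have : lambda \in enum_fset (fset_set S).
    by apply/memS; rewrite gtr0_norm.
  by case: (enum_fset _).
- move=> z1 z2 /sP[r1 [r1P n1]] /sP[r2 [r2P n2]]; apply/sP.
  by exists (fun i => r1 i * r2 i); split;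
    [exact: phaseM | rewrite normrM n1 n2 mulr1].
(* Along the closed walk, [r o = z ^+ m * r o] with [r o] nonzero. *)
- move=> z /sP[r [rP _]]; have /esym := phase_walk rP oo.
  by rewrite -[RHS]mul1r => /(mulIf (rP.1 o)).
by move=> z /sP[r [_ z1]]; rewrite -normr_eq0 z1 oner_eq0.
Qed.

(** * Exponent, order and the trivial module *)

Section Quotient.
Variables (K : fieldType) (H L : hopfAlgType K) (V : vectType K).
Variables (pi : {lrmorphism H -> L}).
Variables (rho : representation H V) (rhoL : representation L V).
Hypothesis pi_hopf : hopf_morphism pi.
Hypothesis rhoLE : forall h, rhoL (pi h) = rho h.

Lemma tpow_rep_quotient m h : tpow_rep rhoL m (pi h) = tpow_rep rho m h.
Proof.
have [comul_pi counit_pi _] := pi_hopf.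
elim: m h => [|m IHm] h /=; first by rewrite /triv_act counit_pi.
rewrite /diag_act /= comul_pi /tmap linear_tlift /=; apply: tlift_ext => a b.
rewrite tlift_tens; last exact: pair_act_bilin.
by apply: tens_lfunP => v w; rewrite !pair_actE rhoLE IHm.
Qed.

End Quotient.

(** * Tensor powers on whose annihilator the counit vanishes *)

Section Exponent.
Variables (K : fieldType) (H : hopfAlgType K) (V : vectType K).
Variable rho : representation H V.

Definition conv_pow m : 'End(H) := iter m (conv \1%VF) (@cunit _ H H).

Lemma bilin_comp_form (F : 'Hom('End(V), K^o)) :
  bilin (fun p q : 'End(V) => F (p \o q)%VF : K^o).
Proof.
by split=> [q|p] a x y; rewrite (comp_lfunDl, comp_lfunDr)
  -(comp_lfunZl, comp_lfunZr) linearP.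
Qed.

(** Since f(ab) is a sum of products f1(a) f2(b) of coefficients, h |-> f(h_(1) ... h_(m)) is a sum
    of m-fold convolution products of coefficients. *)
Lemma coefficient_sweedler_pow m f : coefficient rho f ->
  coefficient (tpow_rep rho m) (f \o conv_pow m)%VF.
Proof.
elim: m f => [|m IHm] f fP x /=; rewrite comp_lfunE /=.
  move=> /lfunP/(_ 1); rewrite scale_lfunE id_lfunE zero_lfunE.
  rewrite [_ *: _]mulr1 => x0.
  by rewrite cunitE x0 scale0r linear0.
move=> x0; rewrite convE linear_tlift.
have [F FE] := coefficient_factor fP.
have [I [f1 [f2 [c [f1P f2P cE]]]]] :=
  bilin_coefficient rho rho (bilin_comp_form F).
pose g i := (f2 i \o conv_pow m)%VF : dual H.
transitivity ((\sum_i c i *: convolution (f1 i) (g i)) x); last first.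
  rewrite sum_lfunE big1 // => i _.
  by rewrite scale_lfunE (coefficient_tens (f1P i) (IHm _ (f2P i)) x0) scaler0.
rewrite sum_lfunE; under [RHS]eq_bigr do rewrite scale_lfunE convolutionE.
rewrite -tlift_sum; apply: tlift_ext => a b /=.
rewrite id_lfunE FE repM cE; apply: eq_bigr => i _.
by rewrite comp_lfunE.
Qed.

(** For each coefficient f of V, the form h |-> f(h_(1) ... h_(e)) = eps(h) f(1) is a coefficient of
    the e-th power and vanishes at x. Thus eps(x) 1 acts by zero on the nonzero space V. *)
Lemma exponent_counit e x : {:V}%VS != 0%VS ->
  (forall h : H, sweedler_pow e h = (counit h : K) *: 1) ->
  tpow_rep rho e x = 0 -> counit x = 0.
Proof.
move=> V0 eE x0; have : rho ((counit x : K) *: 1) = 0.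
  apply: rep_coefficientP => f /(@coefficient_sweedler_pow e)/(_ _ x0).
  by rewrite comp_lfunE -eE sweedler_powE.
rewrite linearZ /= rep1 => /eqP; rewrite scaler_eq0 => /orP[/eqP //|/eqP id0].
case/eqP: V0; apply/eqP; rewrite -subv0; apply/subvP=> v _.
by rewrite memv0 -[v]id_lfunE id0 zero_lfunE.
Qed.

Lemma invariant_counit m (w : tpow V m) x : w != 0 -> Defs.invariant rho w ->
  tpow_rep rho m x = 0 -> counit x = 0.
Proof.
move=> w0 wH x0; have /esym/eqP := wH x.
by rewrite x0 zero_lfunE scaler_eq0 (negPf w0) orbF => /eqP.
Qed.

(* The contraction of the second tensor factor of [comul x] with a matrix
   coefficient of [sigma] vanishes; recombine using the antipode. *)
Lemma tens_tpow_counit W (sigma : representation H W) x : {:W}%VS != 0%VS ->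
  (forall y, tpow_ann rho y -> y = 0) ->
  (forall m, tens_rep (tpow_rep rho m) sigma x = 0) -> counit x = 0.
Proof.
move=> W0 ann0 x0.
have y0 c : coefficient sigma c ->
    tlift (fun a b => (c b : K) *: a) (comul x) = 0.
  move=> cP; apply/ann0/tpow_annP => m f fP.
  rewrite linear_tlift -[RHS](coefficient_tens fP cP (x0 m)) convolutionE.
  by apply: tlift_ext => a b; rewrite linearZ /= [LHS]mulrC.
have : sigma ((counit x : K) *: 1) = 0.
  rewrite -antipodel linear_tlift.
  pose E (k : 'I_(\dim {:'End(W)})) := (vbasis {:'End(W)})`_k.
  pose c k := form_coef sigma (coord (vbasis {:'End(W)}) k).
  pose Psi k a := (sigma (antipode a) \o E k)%VF.
  have Psi_lin k : linear (Psi k).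
    by move=> a y z; rewrite /Psi !linearP /= comp_lfunDl -comp_lfunZl.
  pose PsiL k : {linear H -> 'End(W)} :=
    HB.pack (Psi k) (GRing.isLinear.Build K H 'End(W) _ (Psi k) (Psi_lin k)).
  (* The operator [sigma b] is expanded in the basis [E] and its coordinates are moved to the first
     tensor factor, where the contractions are zero by [y0]. The scalar 1 only gives the sum the
     shape of [tlift_sum]. *)
  rewrite (tlift_ext (g := fun a b => \sum_k 1 *: PsiL k ((c k b : K) *: a))).
    rewrite tlift_sum big1 // => k _; rewrite scale1r -linear_tlift.
    by rewrite y0 ?linear0 //; exact: coefficient_form.
  move=> a b; apply/lfunP=> w; rewrite /= repM comp_lfunE.
  rewrite {1}(coord_vbasis (memvf (sigma b))) !sum_lfunE linear_sum.
  apply: eq_bigr => k _; rewrite scale1r /= /Psi !linearZ /= comp_lfunE.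
  by rewrite scale_lfunE linearZ scale_lfunE form_coefE.
rewrite linearZ /= rep1 => /eqP; rewrite scaler_eq0 => /orP[/eqP //|/eqP id0].
case/eqP: W0; apply/eqP; rewrite -subv0; apply/subvP=> v _.
by rewrite memv0 -[v]id_lfunE id0 zero_lfunE.
Qed.

End Exponent.

(** * The fusion graph *)

Section FusionGraph.
Variables (K : fieldType) (charK : [pchar K] =i pred0).
Variables (L : hopfAlgType K) (ssL : semisimple L).
Variables (V : vectType K) (rho : representation L V).
Variables (k : nat) (chi : 'I_k -> dual L).
Hypothesis irr_chi : irreducible_characters chi.
Variables (A : 'M[nat]_k) (A_def : left_mult_matrix chi (character rho) A).

Let phi := convolution (character rho).

Lemma convolution_sumr (I : finType) (c : I -> K) (f : I -> dual L) g :
  convolution g (\sum_i c i *: f i) = \sum_i c i *: convolution g (f i).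
Proof.
have lin_g : linear (fun f => convolution g f : dual L).
  move=> a f1 f2; apply/lfunP=> x.
  rewrite add_lfunE scale_lfunE !convolutionE -tlift_linear_fun.
  by apply: tlift_ext => b d; rewrite add_lfunE scale_lfunE mulrDr -scalerAr.
exact: (linear_sumZ c f lin_g).
Qed.

(** The [c i] form column j of the m-th power of A. As they are natural numbers, a nonzero sum has a
    nonzero summand, which extends a walk. *)
Lemma iter_mult_walk m j : exists c : 'I_k -> nat,
  iter m phi (chi j) = \sum_i (c i)%:R *: chi i /\
  forall i, c i != 0%N -> walk A m j i.
Proof.
elim: m => [|m [c [cE cA]]] /=.
  exists (fun i => (i == j)%N : nat); split=> [|i];
    last by rewrite eqb0 negbK => /eqP.
  by rewrite (bigD1 j) //= eqxx scale1r big1 ?addr0 // => i /negPf->;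
    rewrite scale0r.
exists (fun i => \sum_l A i l * c l)%N; split=> [|i].
  rewrite cE {1}/phi convolution_sumr.
  under [LHS]eq_bigr do rewrite A_def scaler_sumr.
  rewrite exchange_big; apply: eq_bigr => i _ /=.
  rewrite natr_sum scaler_suml; apply: eq_bigr => l _.
  by rewrite scalerA natrM mulrC.
rewrite sum_nat_eq0 negb_forall => /existsP[l].
rewrite muln_eq0 negb_or => /andP[Ail cl].
by exists l => //; exact: cA.
Qed.

(** A nonzero idempotent operator has nonzero trace in characteristic zero, so the idempotent
    attached to the simple module j separates [chi j] from the other irreducible characters. *)
Lemma chi_idempotent j : exists e : L,
  [/\ e * e = e, chi j e != 0 & forall i, i != j -> chi i e = 0].
Proof.
have [chi_inj chiP] := irr_chi.
have irrP i : irreducible_character (chi i) by apply/chiP; exists i.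
have [W [sigma [irrS chij]]] := irrP j.
have [e [ee se eP]] := irreducible_idempotent ssL irrS; exists e;
  split=> // [|i ij].
  rewrite chij characterE; apply: contraNneq se => /(lftrace_idem charK)->//.
  by rewrite -repM ee.
have [U [tau [irrT chii]]] := irrP i.
have [te|/(eP _ _ irrT)] := eqVneq (tau e) 0.
  by rewrite chii characterE te linear0.
by rewrite -chij -chii => /chi_inj/eqP; rewrite (negPf ij).
Qed.

(* If a component j does not occur in a module, then its idempotent has trace
   zero on that module, hence kills it. *)
Lemma walk_of_action j l (I : Type) (P : I -> nat) (X : I -> vectType K)
    (tau : forall i, representation L (X i)) :
  (forall i, character (tau i) = iter (P i) phi (chi j)) ->
  (forall x, (forall i, tau i x = 0) -> chi l x = 0) ->
  exists i, walk A (P i) j l.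
Proof.
move=> tauE tau0; have [e [ee el else0]] := chi_idempotent l.
apply: contrapT => nowalk; case/eqP: el; apply: tau0 => i.
apply: (lftrace_idem charK); first by rewrite -repM ee.
have [c [cE cA]] := iter_mult_walk (P i) j.
rewrite -characterE tauE cE sum_lfunE big1 // => l' _; rewrite scale_lfunE.
have [->|/else0->] := eqVneq l' l; last by rewrite scaler0.
have [->|/cA wl] := eqVneq (c l) 0%N; first by rewrite scale0r.
by case: nowalk; exists i.
Qed.

Lemma character_tpow m :
  character (tpow_rep rho m) = iter m phi (character (triv_rep L)).
Proof. by elim: m => [|m IHm] //=; rewrite character_tens IHm. Qed.

Lemma convolution1 f : convolution (character (triv_rep L)) f = f.
Proof.
apply/lfunP=> x; rewrite convolutionE -[in RHS](counitl x) linear_tlift.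
by apply: tlift_ext => a b; rewrite character_triv linearZ.
Qed.

Lemma convolution_iter m f g :
  convolution (iter m phi f) g = iter m phi (convolution f g).
Proof. by elim: m => [|m IHm] //=; rewrite /phi convolutionA IHm. Qed.

Lemma trivial_index : exists o, chi o = character (triv_rep L).
Proof.
have [_ chiP] := irr_chi.
have /chiP[o ->] : irreducible_character (character (triv_rep L)).
  by exists K^o, (triv_rep L); split=> //; exact: irreducible_triv.
by exists o.
Qed.

Hypothesis faithful : forall y, tpow_ann rho y -> y = 0.
Variable o : 'I_k.
Hypothesis chi_o : chi o = character (triv_rep L).

(** The tensor powers of V are jointly faithful, so every simple module is a constituent of one of
    them. *)
Lemma walk_from_trivial j : exists m, walk A m o j.
Proof.
apply: (walk_of_action (P := id) (tau := tpow_rep rho)) => [m|x x0].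
  by rewrite character_tpow chi_o.
by rewrite (faithful x0) linear0.
Qed.

(** An element killing all V^{⊗m} ⊗ W, with W the simple module j, has counit zero; so the trivial
    module occurs in one of these products. *)
Lemma walk_to_trivial j : exists m, walk A m j o.
Proof.
have [W [sigma [irrS chij]]] : irreducible_character (chi j).
  by apply/irr_chi.2; exists j.
apply: (walk_of_action (P := id)
  (tau := fun m => tens_rep (tpow_rep rho m) sigma)) => [m|].
  rewrite character_tens character_tpow -chij convolution_iter.
  by rewrite convolution1.
move=> x /(tens_tpow_counit irrS.1 faithful) x0.
by rewrite chi_o character_triv.
Qed.

Lemma walk_closed m :
  (forall x, tpow_rep rho m x = 0 -> counit x = 0) -> walk A m o o.
Proof.
(* A family with one member, indexed by [unit], fixes the length m of the walk. *)
move=> m0; have [_ //] : exists _ : unit, walk A m o o.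
apply: (walk_of_action (P := fun=> m) (tau := fun=> tpow_rep rho m)).
  by move=> _; rewrite character_tpow chi_o.
move=> x /(_ tt)/m0 x0.
by rewrite chi_o character_triv.
Qed.

(** Characters take the dimension as value at 1, so evaluating the relations that define A at 1
    gives the equations in K; characteristic zero brings them back to natural numbers. *)
Lemma chi_dim : exists d : 'I_k -> nat, [/\ forall i, (0 < d i)%N
  & forall j, (\sum_i A i j * d i = \dim {:V} * d j)%N].
Proof.
have /fin_all_exists[d dP] i : exists d, (0 < d)%N /\ chi i 1 = d%:R.
  have [W [sigma [irrS ->]]] : irreducible_character (chi i).
    by apply/irr_chi.2; exists i.
  by exists (\dim {:W}); rewrite character1 lt0n dimv_eq0 irrS.1.
exists d; split=> [i|j]; first by have [] := dP i.
apply: (natr_inj_pchar0 charK) => /=; rewrite natrM -(dP j).2 -(character1 rho).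
have := A_def j => /lfunP/(_ 1); rewrite convolutionE comul1.
rewrite tlift_tens; last exact: (@bilin_mul _ _ _ K^o).
move=> ->; rewrite sum_lfunE natr_sum; apply: eq_bigr => i _.
by rewrite scale_lfunE (dP i).2 natrM.
Qed.

End FusionGraph.

Theorem proposition5p4 (R : realType) (K : closedFieldType)
    (charK : [pchar K] =i pred0)
    (H : hopfAlgType K) (ssH : semisimple H)
    (V : vectType K) (rho : representation H V) (V_neq0 : {:V}%VS != 0%VS) :
  hopf_ideal (tpow_ann rho) /\
  forall (L : hopfAlgType K) (pi : {lrmorphism H -> L})
         (HJ : is_hopf_quotient (tpow_ann rho) pi)
         (rhoL : representation L V)
         (rhoLE : forall h, rhoL (pi h) = rho h)
         (k : nat) (chi : 'I_k -> dual L) (irr_chi : irreducible_characters chi)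
         (A : 'M[nat]_k) (A_def : left_mult_matrix chi (character rhoL) A)
         (lambda : R[i])
         (lambda_PF : perron_frobenius_eigenvalue A lambda),
    (forall e, is_exponent H e -> (imprimitivity_index A lambda %| e)%N) /\
    (forall m, is_order rho m -> (imprimitivity_index A lambda %| m)%N).
Proof.
split=> [|L pi [pi_hopf pi_surj kerE] rhoL rhoLE].
  exact: tpow_ann_hopf_ideal.
move=> k chi irr_chi A A_def lambda PF.
have tpowE := tpow_rep_quotient pi_hopf rhoLE.
have ssL := semisimple_quotient pi_surj ssH.
have faithful y : tpow_ann rhoL y -> y = 0.
  have [h <-] := pi_surj y => yJ; apply/kerE => m.
  by rewrite -tpowE; exact: yJ.
have [o chi_o] := trivial_index irr_chi.
have [d [d_gt0 dA]] := chi_dim charK irr_chi A_def.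
have n_gt0 : (0 < \dim {:V})%N by rewrite lt0n dimv_eq0.
(* The exponent and the order enter only through this property, which yields a closed walk of length
   m at the trivial module. *)
have dvd m : (forall x, tpow_rep rho m x = 0 -> counit x = 0) ->
    (imprimitivity_index A lambda %| m)%N.
  move=> m0; apply: (imprimitivity_index_dvd n_gt0 d_gt0 dA _ _ PF).
  - exact: (walk_to_trivial charK ssL irr_chi A_def faithful chi_o).
  - exact: (walk_from_trivial charK ssL irr_chi A_def faithful chi_o).
  apply: (walk_closed charK ssL irr_chi A_def chi_o) => y.
  have [h <-] := pi_surj y.
  by rewrite tpowE; have [_ -> _] := pi_hopf; exact: m0.
split=> [e [_ eE _]|m [_ [w w0 wH] _]]; apply: dvd => x.
  exact: exponent_counit.
exact: invariant_counit w0 wH.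
Qed.
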